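(* Let $\mathcal H$ be a separable Hilbert space, $(X,\mathcal M,\mu)$ a non-atomic measure space, and $\{\phi_t\}_{t\in X}$ a continuous Bessel family over $X$ in $\mathcal H$. Then there exists a continuous Bessel family $\{\psi_t\}_{t\in I}$ over the interval $I=[0,\mu(X))$ equipped with Lebesgue measure $\lambda$ (with $I=[0,\infty)$ if $\mu(X)=\infty$) such that $$\mu(\{t\in X:\phi_t\in U\})=\lambda(\{t\in I:\psi_t\in U\})\quad\text{for every open }U\subset\mathcal H\setminus\{0\}.$$
   Context: A family $\{\phi_t\}_{t\in X}$ of vectors in $\mathcal H$ is a continuous Bessel family (with bound $B$) over the measure space $(X,\mu)$ if (i) for each $f\in\mathcal H$ the function $t\mapsto\langle f,\phi_t\rangle$ is measurable, and (ii) there is $B<\infty$ with $\int_X|\langle f,\phi_t\rangle|^2\,d\mu(t)\le B\|f\|^2$ for all $f\in\mathcal H$. *)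

(* Defs.v *)
From mathcomp Require Import all_boot all_algebra.
From mathcomp Require Import all_classical all_reals all_analysis.
From mathcomp Require Import complex.
Set Implicit Arguments. Unset Strict Implicit. Unset Printing Implicit Defensive.
Import GRing.Theory Num.Theory.
Local Open Scope classical_set_scope.
Local Open Scope ring_scope.

Section Hilbert.
Variables (R : realType) (V : lmodType R[i]) (ip : V -> V -> R[i]).

Definition is_inner_product : Prop :=
  [/\ (forall (a : R[i]) (x y z : V), ip (a *: x + y) z = a * ip x z + ip y z),
      (forall x y : V, ip y x = conjc (ip x y)),
      (forall x : V, 0 <= complex.Re (ip x x)) &
      (forall x : V, ip x x = 0 -> x = 0)].

Definition hnorm (x : V) : R := Num.sqrt (complex.Re (ip x x)).

Definition hcomplete : Prop :=
  forall u : nat -> V,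
    (forall e : R, 0 < e -> exists N : nat, forall m n : nat,
        (N <= m)%N -> (N <= n)%N -> hnorm (u m - u n) < e) ->
    exists x : V, forall e : R, 0 < e -> exists N : nat, forall n : nat,
        (N <= n)%N -> hnorm (u n - x) < e.

Definition hseparable : Prop :=
  exists s : nat -> V, forall (x : V) (e : R), 0 < e ->
    exists n : nat, hnorm (x - s n) < e.

Definition separable_hilbert : Prop :=
  [/\ is_inner_product, hcomplete & hseparable].

Definition hopen (U : set V) : Prop :=
  forall x, U x -> exists2 e : R, 0 < e & forall y, hnorm (y - x) < e -> U y.

Definition abs2 (z : R[i]) : R := complex.Re z ^+ 2 + complex.Im z ^+ 2.

Definition bessel_family {d} {T : measurableType d}
    (mu : {measure set T -> \bar R}) (D : set T) (phi : T -> V) : Prop :=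
  (forall f : V,
     measurable_fun D (fun t => complex.Re (ip f (phi t))) /\
     measurable_fun D (fun t => complex.Im (ip f (phi t)))) /\
  exists B : R, forall f : V,
    (\int[mu]_(t in D) (abs2 (ip f (phi t)))%:E <= (B * hnorm f ^+ 2)%:E)%E.

End Hilbert.

Definition nonatomic {R : realType} {d} {T : measurableType d}
    (mu : {measure set T -> \bar R}) : Prop :=
  forall A : set T, measurable A -> (0 < mu A)%E ->
    exists B : set T, [/\ measurable B, B `<=` A & (0 < mu B < mu A)%E].

Definition Iint {R : realType} (m : \bar R) : set R :=
  [set x : R | 0 <= x /\ (x%:E < m)%E].

(* Main.v *)
(* Fix a countable base of balls of H. The set S where phi is nonzero is covered
   by the sets {|<s_k, phi>|^2 >= 1/m}, s_k dense, which have finite measure by the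
   Bessel bound. A real function c, negative off S, records on its integer part an
   index of a set of this cover and on its fractional part, in base 4, which basic
   balls contain phi t; hence phi = Psi o c for a Borel function Psi that vanishes
   on the negative numbers, and the image of mu under c is finite on bounded
   intervals of [0, +oo[. A quantile function q carries Lebesgue measure on
   ]0, mu S[ to the restriction of this image measure to [0, +oo[, and
   psi = Psi o q. *)
Require Import Defs.
From HB Require Import structures.
From mathcomp Require Import all_boot all_order all_algebra.
From mathcomp Require Import all_classical all_reals all_analysis.
From mathcomp Require Import complex measurable_realfun lra ring.
Set Implicit Arguments. Unset Strict Implicit. Unset Printing Implicit Defensive.
Import Order.TTheory GRing.Theory Num.Theory.
Local Open Scope classical_set_scope.
Local Open Scope ring_scope.

(** * Borel measures on the half-line and quantile functions *)

Lemma measurable_generated_Nyc (R : realType) :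
  (@measurable _ (measurableTypeR R)) =
  <<s [set A : set R | exists x, A = `]-oo, x]%classic] >>.
Proof.
transitivity <<s @RGenOInfty.G R >>.
  exact (RGenOInfty.measurableE R).
rewrite eqEsubset; split; (apply: smallest_sub; first exact: smallest_sigma_algebra).
- move=> _ [x ->]; rewrite -setCitvl.
  rewrite -setTD; apply: sigma_algebraCD.
  by apply: sub_sigma_algebra; exists x.
- move=> _ [x ->]; rewrite -setCitvr.
  rewrite -setTD; apply: sigma_algebraCD.
  by apply: sub_sigma_algebra; exists x.
Qed.

(** The rays []-oo, x]] form a generating class stable under intersection, on which the restrictions
    to [[0, +oo[] agree; finiteness on [[0, n]] makes the rays []-oo, n]] an exhausting sequence of
    finite measure. *)
Lemma eq_measure_nonneg (R : realType)
    (m1 m2 : {measure set (measurableTypeR R) -> \bar R}) :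
  (forall x : R, 0 <= x -> m1 `[0%R, x]%classic = m2 `[0%R, x]%classic) ->
  (forall x : R, (m1 `[0%R, x]%classic < +oo)%E) ->
  forall A : set (measurableTypeR R), measurable A -> A `<=` `[0%R, +oo[%classic -> m1 A = m2 A.
Proof.
move=> m12 m1oo A mA A0.
have mD : measurable (`[0%R, +oo[%classic : set (measurableTypeR R)).
  exact: measurable_itv.
have IE x : `]-oo, x]%classic `&` `[0%R, +oo[%classic = `[0%R, x]%classic :> set R.
  apply/seteqP; split => y /=; rewrite !in_itv/= andbT; first by move=> [-> ->].
  by move=> /andP[].
suff: mrestr m1 mD A = mrestr m2 mD A by rewrite /mrestr setIidl.
pose G : set (set (measurableTypeR R)) :=
  [set A : set R | exists x, A = `]-oo, x]%classic].
pose g n : set (measurableTypeR R) := `]-oo, n%:R : R]%classic.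
apply: (measure_unique G g _ _ _ _ (mrestr m1 mD) (mrestr m2 mD)) => //.
- exact: measurable_generated_Nyc.
- move=> _ _ [x ->] [y ->]; exists (Num.min x y).
  by apply/seteqP; split => z /=; rewrite !in_itv/= le_min => /andP.
- by move=> i; exists i%:R.
- apply/seteqP; split => // x _; exists (Num.truncn (x : R)).+1 => //=.
  by rewrite /g/= in_itv/= ltW// truncnS_gt.
- move=> _ [x ->]; rewrite /= /mrestr/= IE.
  case: (leP 0 x) => [|x0]; first exact: m12.
  by rewrite set_itv_ge ?bnd_simp -?ltNge// !measure0.
- by move=> k; rewrite /= /mrestr IE.
Qed.

(* [q] is the quantile function of the restriction of [nu] to [`[0, +oo[]; the
   value [-1] marks the points outside [`]0, nu `[0, +oo[[]. *)
Lemma quantile_transport (R : realType)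
    (nu : {measure set (measurableTypeR R) -> \bar R}) :
  (forall x : R, (nu `[0%R, x]%classic < +oo)%E) ->
  exists q : measurableTypeR R -> measurableTypeR R,
    [/\ measurable_fun setT q,
        forall s, 0 <= q s -> 0 <= s /\ (s%:E < nu `[0%R, +oo[%classic)%E &
        forall A : set (measurableTypeR R), measurable A -> A `<=` `[0%R, +oo[%classic ->
          nu A = lebesgue_measure (q @^-1` A)].
Proof.
move=> nuoo.
pose F x := nu `[0%R, x]%classic; pose M := nu `[0%R, +oo[%classic.
have FM x : (F x <= M)%E.
  apply: le_measure; rewrite ?inE//; try exact: measurable_itv.
  by move=> y /=; rewrite !in_itv/= => /andP[->].
have F_nd x y : x <= y -> (F x <= F y)%E.
  move=> xy; apply: le_measure; rewrite ?inE//; try exact: measurable_itv.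
  by apply: subset_itvl; rewrite bnd_simp.
(* Continuity from below: [F n] tends to [M], so every level below [M] is reached. *)
have F_sup s : (s%:E < M)%E -> exists2 x, 0 <= x & (s%:E <= F x)%E.
  move=> sM; apply: contrapT => h.
  suff : (M <= s%:E)%E by rewrite leNgt sM.
  have ME : M = nu (\bigcup_n `[0%R, n%:R]%classic).
    congr (nu _); apply/seteqP; split=> x /=; rewrite in_itv/=.
      rewrite andbT => x0; exists (Num.truncn x).+1 => //=.
      by rewrite in_itv/= x0 ltW// truncnS_gt.
    by move=> [n _]/=; rewrite in_itv/= => /andP[->].
  have Fcvg : nu \o (fun n => `[0%R, n%:R]%classic) @ \oo --> M.
    rewrite ME; apply: nondecreasing_cvg_mu => [n||m n mn].
    - exact: measurable_itv.
    - by apply: bigcup_measurable => n _; exact: measurable_itv.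
    - by apply/subsetPset/subset_itvl; rewrite bnd_simp ler_nat.
  rewrite -(cvg_lim _ Fcvg)//; apply: lime_le; first by apply/cvg_ex; exists M.
  apply: nearW => n /=; rewrite leNgt; apply/negP => sF; apply: h.
  by exists n%:R => //; exact: ltW.
(* Right continuity of [F], by continuity from above along [[0, x + 1/(n+1)]], where the measure is
   finite. *)
have F_rc (s : \bar R) (x : R) : (forall e : R, 0 < e -> (s <= F (x + e)%R)%E) -> (s <= F x)%E.
  move=> h.
  have FE : F x = nu (\bigcap_n `[0%R, x + n.+1%:R^-1]%classic).
    congr (nu _); apply/seteqP; split=> y /=; rewrite in_itv/=.
      move=> /andP[y0 yx] n _ /=; rewrite in_itv/= y0/=.
      by rewrite (le_trans yx)// lerDl.
    move=> H; have := H 0%N I; rewrite /= in_itv/= => /andP[-> _]/=.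
    apply/ler_addgt0Pr => e e0.
    have := H (Num.truncn e^-1) I; rewrite /= in_itv/= => /andP[_ /le_trans]; apply.
    rewrite lerD2l -[leRHS]invrK lef_pV2 ?posrE ?invr_gt0//.
    by apply/ltW/truncnS_gt.
  have Fcvg : nu \o (fun n => `[0%R, x + n.+1%:R^-1]%classic) @ \oo --> F x.
    rewrite FE; apply: nonincreasing_cvg_mu => [|n||m n mn].
    - exact: nuoo.
    - exact: measurable_itv.
    - by apply: bigcap_measurable => [|n _]; [exists 0%N|exact: measurable_itv].
    - apply/subsetPset/subset_itvl; rewrite bnd_simp lerD2l.
      by rewrite lef_pV2 ?posrE// ler_nat.
  rewrite -(cvg_lim _ Fcvg)//; apply: lime_ge; first by apply/cvg_ex; exists (F x).
  by apply: nearW => n /=; exact: h.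
pose D : set R := [set s | 0 < s /\ (s%:E < M)%E].
pose L s : set R := [set x | 0 <= x /\ (s%:E <= F x)%E].
pose q s : R := if `[< D s >] then inf (L s) else -1.
have L0 s : D s -> L s !=set0.
  by move=> [_ /F_sup[x x0 sx]]; exists x.
have Llb s : lbound (L s) 0 by move=> x [].
have q0 s : D s -> 0 <= q s.
  by move=> Ds; rewrite /q asboolT//; apply: lb_le_inf => //; exact: L0.
have qN s : ~ D s -> q s = -1 by move=> Ds; rewrite /q asboolF.
have qD s : 0 <= q s -> D s.
  by move=> qs; apply: contrapT => /qN qE; move: qs; rewrite qE lerNr oppr0 ler10.
(* Galois relation between [q] and [F]: right continuity makes the infimum defining [q s]
   attained. *)
have qF s x : D s -> 0 <= x -> (q s <= x) = (s%:E <= F x)%E.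
  move=> Ds x0; rewrite /q asboolT//; apply/idP/idP => [qx|sF].
    apply: F_rc => e e0.
    have : inf (L s) < x + e by rewrite (le_lt_trans qx)// ltrDl.
    move=> /(inf_lt (L0 _ Ds))[y [y0 sy] /ltW /F_nd].
    exact: le_trans.
  by apply: ge_inf => //; exists 0.
have Ditv : is_interval D.
  move=> s t [s0 _] [_ tM] u /andP[su ut]; split; first exact: lt_le_trans su.
  by rewrite (le_lt_trans _ tM)// lee_fin.
have mD : measurable (D : set (measurableTypeR R)) by exact: is_interval_measurable.
have mDF x : measurable (D `&` [set s | s%:E <= F x]%E : set (measurableTypeR R)).
  apply: is_interval_measurable => s t [Ds _] [Dt tF] u /andP[su ut]; split.
    by apply: (Ditv s t) => //; rewrite su.
  by rewrite /= (le_trans _ tF)// lee_fin.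
have q_itv x : 0 <= x ->
    q @^-1` `[0%R, x]%classic = D `&` [set s | s%:E <= F x]%E.
  move=> x0; apply/seteqP; split => s /=; rewrite in_itv/=.
    by move=> /andP[/qD Ds]; rewrite qF.
  by move=> [Ds sF]; rewrite q0// qF.
have mq : measurable_fun setT (q : measurableTypeR R -> measurableTypeR R).
  apply: (measurability _ (measurable_generated_Nyc R)) => _ [_ [x ->] <-].
  (* As [q] is [-1] off [D] and nonnegative on [D], the preimage changes form at [-1] and at [0]. *)
  rewrite setTI; have [x0|x0] := leP 0 x.
    have -> : q @^-1` `]-oo, x]%classic = ~` D `|` (D `&` [set s | s%:E <= F x]%E).
      apply/seteqP; split => s /=; rewrite in_itv/=.
        by move=> qx; have [Ds|] := pselect (D s); [right; rewrite -qF|left].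
      by move=> [/qN ->|[Ds]]; [rewrite (le_trans _ x0)// lerN10|rewrite qF].
    by apply: measurableU; [exact: measurableC|exact: mDF].
  have [x1|x1] := leP (-1) x.
    have -> : q @^-1` `]-oo, x]%classic = ~` D.
      apply/seteqP; split => s /=; rewrite in_itv/=.
        by move=> qx /q0 /le_trans /(_ qx); rewrite leNgt x0.
      by move=> /qN ->.
    exact: measurableC.
  rewrite (_ : _ @^-1` _ = set0); first exact: measurable0.
  apply/seteqP; split => s //=; rewrite in_itv/= => qx.
  have [Ds|/qN qE] := pselect (D s).
    by have := le_trans (q0 _ Ds) qx; rewrite leNgt x0.
  by move: qx; rewrite qE leNgt x1.
exists q; split => //.
  by move=> s /qD[s0 sM]; rewrite ltW.
pose mqm := isMeasurableFun.Build _ _ _ _ _ mq.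
pose Q : {mfun measurableTypeR R >-> measurableTypeR R} := HB.pack q mqm.
apply: (@eq_measure_nonneg R nu (pushforward lebesgue_measure Q)) => // x x0.
rewrite /= /pushforward /= q_itv// -/(F x).
have Ffin : F x \is a fin_num by rewrite ge0_fin_numE ?nuoo// measure_ge0.
have f0 : 0 <= fine (F x) by apply: fine_ge0; exact: measure_ge0.
(* The preimage of [[0, x]] lies between []0, F x[] and []0, F x]], both of length [F x]; its right
   end is missing when [F x = M]. *)
apply/eqP; rewrite eq_le; apply/andP; split.
  apply: (@le_trans _ _ (lebesgue_measure (`]0%R, fine (F x)[%classic : set R))).
    rewrite lebesgue_measure_itv/= lte_fin.
    have [_|] := ltP 0 (fine (F x)); first by rewrite sube0 fineK.
    by rewrite -lee_fin fineK.
  apply: le_measure; rewrite ?inE//; try exact: measurable_itv.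
  move=> s /=; rewrite in_itv/= => /andP[s0]; rewrite -lte_fin fineK// => sF.
  by split; [split => //; exact: lt_le_trans (FM x)|exact: ltW].
apply: (@le_trans _ _ (lebesgue_measure (`]0%R, fine (F x)]%classic : set R))).
  apply: le_measure; rewrite ?inE//; try exact: measurable_itv.
  by move=> s [[s0 _]/= sF]; rewrite /= in_itv/= s0 -lee_fin fineK.
rewrite lebesgue_measure_itv/= lte_fin.
have [_|] := ltP 0 (fine (F x)); first by rewrite sube0 fineK.
by move=> _; exact: measure_ge0.
Qed.

(** * Encoding sequences of measurable sets in one real function *)

Lemma measurable_fun_natr (R : realType) d (X : measurableType d) (k : X -> nat) :
  (forall n, measurable (k @^-1` [set n])) ->
  measurable_fun setT (fun t => (k t)%:R : R).
Proof.
move=> mk _ Y mY; rewrite setTI.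
rewrite (_ : _ @^-1` _ = \bigcup_(n in [set n | Y n%:R]) k @^-1` [set n]).
  by apply: bigcup_measurable => n _; exact: mk.
by apply/seteqP; split=> t /=; [move=> Yt; exists (k t)|move=> [n Yn ->]].
Qed.

(** The shift by one reserves [0] for points outside all [A n]; elsewhere [k t] is the successor of
    the least index of a set containing [t]. *)
Lemma first_index (X : Type) (A : nat -> set X) : exists k : X -> nat,
  k @^-1` [set 0%N] = ~` (\bigcup_n A n) /\
  forall n, k @^-1` [set n.+1] = A n `\` \bigcup_(i < n) A i.
Proof.
have /choice[k kP] (t : X) : exists k : nat,
    (k = 0%N /\ forall n, ~ A n t) \/
    (exists n, [/\ k = n.+1, A n t & forall i, (i < n)%N -> ~ A i t]).
  have [h|/forallNP h] := pselect (exists n, A n t); last by exists 0%N; left.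
  have h' : exists n, `[< A n t >] by case: h => n nt; exists n; exact/asboolP.
  case: (ex_minnP h') => n /asboolP nt nmin; exists n.+1; right; exists n.
  split => // i i_n /asboolP /nmin; by rewrite leqNgt i_n.
exists k; split=> [|n]; apply/seteqP; split=> t /=.
- move=> k0; have [[_ h] [n _ /h]//|[n [kn]]] := kP t; by rewrite kn in k0.
- move=> h; have [[]//|[n [_ nt _]]] := kP t; by exfalso; apply: h; exists n.
- move=> kn; have [[k0]|[m [km mt mmin]]] := kP t; first by rewrite k0 in kn.
  by move: kn; rewrite km => -[<-]; split => // -[i /= im]; exact: mmin.
- move=> [nt nmin]; have [[_ /(_ n)]//|[m [-> mt mmin]]] := kP t.
  have [nm|mn|->//] := ltngtP m n; last by have := mmin _ mn.
  by exfalso; apply: nmin; exists m.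
Qed.

(* Base [4] with digits [0] and [1]: after the [j]-th digit the tail is at most
   a third of a unit, so that the [j]-th digit is the parity of
   [floor (4 ^ j.+1 * c)], which is left unchanged when a natural number is
   added to [c]. *)
Lemma digit_code (R : realType) d (X : measurableType d) (B : nat -> set X) :
  (forall j, measurable (B j)) ->
  exists (c : X -> R) (D : nat -> set R),
    [/\ measurable_fun setT c, (forall t, 0 <= c t < 1),
        (forall j, measurable (D j)) &
        forall j (m : nat) t, D j (m%:R + c t) <-> B j t].
Proof.
move=> mB.
pose b j t : nat := `[< B j t >].
pose P n t : R := \sum_(i < n) (b i t)%:R / 4 ^+ i.+1.
pose N := fix N n t : nat := if n is n'.+1 then (4 * N n' t + b n' t)%N else 0%N.
have p4 n : 0 < 4 ^+ n :> R by rewrite exprn_gt0.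
have PN n t : 4 ^+ n * P n t = (N n t)%:R.
  elim: n => [|n IH]; first by rewrite /P big_ord0 mulr0.
  rewrite /P big_ord_recr/= -/(P n t) mulrDr {1}exprS -mulrA IH.
  by rewrite natrD natrM mulrCA divff ?mulr1// gt_eqF.
have P_nd t m n : (m <= n)%N -> P m t <= P n t.
  move=> /subnK <-; elim: (n - m)%N => // k IH; rewrite (le_trans IH)//.
  by rewrite addSn /P big_ord_recr/= lerDl divr_ge0// ltW.
(* [1 / (3 * 4 ^ n)] is the value of a tail of digits all equal to [1] after the first [n], so
   [P n t + 1 / (3 * 4 ^ n)] cannot increase with [n]. *)
have P_tail t n k : P (k + n)%N t + (3 * 4 ^+ (k + n))^-1 <= P n t + (3 * 4 ^+ n)^-1.
  elim: k => // k IH; rewrite (le_trans _ IH)// addSn /P big_ord_recr/=.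
  rewrite -addrA lerD2l.
  have -> : (3 * 4 ^+ (k + n))^-1 = (4 ^+ (k + n).+1)^-1 + (3 * 4 ^+ (k + n).+1)^-1 :> R.
    by rewrite exprS; field; rewrite gt_eqF.
  by rewrite lerD2r ler_piMl ?invr_ge0 ?(ltW (p4 _))// (ler_nat _ _ 1) leq_b1.
have P_ub t n m : P m t <= P n t + (3 * 4 ^+ n)^-1.
  have p3 k : 0 < (3 * 4 ^+ k)^-1 :> R by rewrite invr_gt0 mulr_gt0.
  have [mn|/ltnW /subnK <-] := leqP m n.
    by rewrite (le_trans (P_nd t _ _ mn))// lerDl ltW.
  by apply: le_trans (P_tail t n (m - n)%N); rewrite lerDl ltW.
pose c t := sup (range (P ^~ t)).
have hub t : has_ubound (range (P ^~ t)).
  by exists (P 0%N t + (3 * 4 ^+ 0)^-1) => _ [m _ <-]; exact: P_ub.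
have Pc n t : P n t <= c t by apply: ub_le_sup => //; exists n.
have cP n t : c t <= P n t + (3 * 4 ^+ n)^-1.
  by apply: ge_sup; [exists (P 0%N t); exists 0%N|move=> _ [m _ <-]; exact: P_ub].
pose D j : set R := \bigcup_(K in [set K : nat | odd K])
  `[K%:R / 4 ^+ j.+1, K.+1%:R / 4 ^+ j.+1[%classic.
exists c, D; split.
- apply: (@measurable_fun_cvg _ _ _ _ P) => [n|t _].
    apply: measurable_sum => i; apply: measurable_funM => //.
    apply: measurable_fun_natr => -[|[|n']].
    + rewrite (_ : _ @^-1` _ = ~` B i); first exact: measurableC.
      by apply/seteqP; split => t; rewrite /b/=; case: asboolP.
    + rewrite (_ : _ @^-1` _ = B i) //.
      by apply/seteqP; split => t; rewrite /b/=; case: asboolP.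
    + rewrite (_ : _ @^-1` _ = set0) //.
      by apply/seteqP; split => t; rewrite /b/=; case: asboolP.
  by apply: nondecreasing_cvgn => // m n /P_nd.
- move=> t; have := Pc 0%N t; have := cP 0%N t; rewrite /P big_ord0 expr0 => c1 ->/=.
  by rewrite (le_lt_trans c1)// add0r mulr1 invf_lt1// ltr1n.
- by move=> j; apply: bigcup_measurable => K _; exact: measurable_itv.
move=> j m t.
pose K := (m * 4 ^ j.+1 + N j.+1 t)%N.
(* Both [m * 4 ^ j.+1] and [4 * N j t] are even, which leaves the digit [b j t]. *)
have oddK : odd K <-> B j t.
  rewrite /K oddD oddM oddX/= andbF/= oddD oddM/= oddb /b.
  by split=> /asboolP.
have KE : K%:R = 4 ^+ j.+1 * (m%:R + P j.+1 t).
  by rewrite mulrDr PN /K natrD natrM natrX mulrC.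
have Kc : K%:R / 4 ^+ j.+1 <= m%:R + c t < K.+1%:R / 4 ^+ j.+1.
  rewrite ler_pdivrMr// ltr_pdivlMr// -[K.+1%:R]natr1 KE [(m%:R + c t) * _]mulrC.
  rewrite ler_pM2l// lerD2l Pc/=.
  apply: (@le_lt_trans _ _ (4 ^+ j.+1 * (m%:R + (P j.+1 t + (3 * 4 ^+ j.+1)^-1)))).
    by rewrite ler_pM2l// lerD2l.
  rewrite addrA mulrDr ltrD2l invfM mulrCA divff ?gt_eqF// mulr1.
  by rewrite invf_lt1// ltr1n.
split => [[K' /= oK']|/oddK oK]; last by exists K.
rewrite in_itv/= => /andP[K'1 K'2]; apply/oddK; case/andP: Kc => K1 K2.
have := le_lt_trans K1 K'2; have := le_lt_trans K'1 K2.
rewrite !ltr_pM2r ?invr_gt0// !ltr_nat !ltnS => K'K KK'.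
by rewrite (_ : K = K')//; apply/eqP; rewrite eqn_leq KK'.
Qed.

(** Adding to the digit code the index of the first [A n] containing the point makes each bounded
    range of nonnegative values come from finitely many [A n]; the digits survive because this index
    is a natural number. *)
Lemma real_code (R : realType) d (X : measurableType d) (A B : nat -> set X) :
  (forall n, measurable (A n)) -> (forall j, measurable (B j)) ->
  exists (c : X -> R) (D : nat -> set R),
    [/\ measurable_fun setT c, (forall j, measurable (D j)),
        (forall t, 0 <= c t <-> exists n, A n t),
        (forall x, exists N, [set t | 0 <= c t <= x] `<=` \bigcup_(n < N) A n) &
        forall j t, 0 <= c t -> D j (c t) <-> B j t].
Proof.
move=> mA mB; have [c [D [mc c01 mD cD]]] := digit_code R mB.
have [k [k0 kS]] := first_index A.
have mk n : measurable (k @^-1` [set n]).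
  case: n => [|n]; rewrite ?k0 ?kS.
    by apply: measurableC; exact: bigcupT_measurable.
  by apply: measurableD => //; apply: bigcup_measurable.
(* For [k t = 0] the value is [c t - 1], negative because [c t < 1]. *)
pose f t : R := (k t)%:R - 1 + c t.
have f0 t : k t = 0%N -> f t < 0.
  by move=> kt; rewrite /f kt; have /andP[_] := c01 t; lra.
have fS n t : k t = n.+1 -> f t = n%:R + c t.
  by move=> kt; rewrite /f kt -natr1 addrK.
have f_ge0 t : 0 <= f t -> exists2 n, k t = n.+1 & A n t.
  case E : (k t) => [|n] f0t; first by have := f0 _ E; rewrite ltNge f0t.
  exists n => //; have : (k @^-1` [set n.+1]) t by [].
  by rewrite kS => -[].
exists f, D; split => //.
- apply: measurable_funD => //; apply: measurable_funB => //.
  exact: measurable_fun_natr.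
- move=> t; split; first by move=> /f_ge0[n _ nt]; exists n.
  move=> [n nt]; case E : (k t) => [|m].
    suff : (~` \bigcup_n A n) t by case; exists n.
    by rewrite -k0.
  by rewrite (fS _ _ E) addr_ge0//; have /andP[] := c01 t.
- move=> x; exists (Num.truncn x).+1 => t /= /andP[/f_ge0[n kn nt] fx].
  exists n => //=; rewrite -(ltr_nat R) (le_lt_trans _ (truncnS_gt x))//.
  rewrite (le_trans _ fx)// (fS _ _ kn) lerDl.
  by have /andP[] := c01 t.
- by move=> j t /f_ge0[n kn _]; rewrite (fS _ _ kn); exact: cD.
Qed.

(** * Hilbert space geometry through real parts of inner products *)

Section Hilbert_space.
Variables (R : realType) (V : lmodType R[i]) (ip : V -> V -> R[i]).
Hypothesis hip : is_inner_product ip.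
Local Notation N := (hnorm ip).
Local Notation rip x y := (complex.Re (ip x y)).

Lemma ripDl x y z : rip (x + y) z = rip x z + rip y z.
Proof.
case: hip => lin _ _ _; rewrite -{1}[x]scale1r lin mul1r.
by case: (ip x z) (ip y z) => [? ?] [].
Qed.

Lemma rip0l z : rip 0 z = 0.
Proof. by have := ripDl 0 0 z; rewrite addr0; lra. Qed.

Lemma ip0l z : ip 0 z = 0.
Proof.
case: hip => lin _ _ _; have := lin 1 0 0 z.
by rewrite scale1r addr0 mul1r => /eqP; rewrite -subr_eq0 opprD addNKr oppr_eq0 => /eqP.
Qed.

Lemma ipZl a x z : ip (a *: x) z = a * ip x z.
Proof. by case: hip => lin _ _ _; have := lin a x 0 z; rewrite addr0 ip0l addr0. Qed.

Lemma ripC x y : rip y x = rip x y.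
Proof. by case: hip => _ sym _ _; rewrite sym; case: (ip x y). Qed.

Lemma ripZl (a : R) x z : rip (a%:C%C *: x) z = a * rip x z.
Proof. by rewrite ipZl; case: (ip x z) => u v /=; rewrite mul0r subr0. Qed.

Lemma ripNl x z : rip (- x) z = - rip x z.
Proof. by have := ripDl (- x) x z; rewrite addNr rip0l; lra. Qed.

Lemma ripBl x y z : rip (x - y) z = rip x z - rip y z.
Proof. by rewrite ripDl ripNl. Qed.

Lemma ripDr x y z : rip z (x + y) = rip z x + rip z y.
Proof. by rewrite ripC ripDl !(ripC _ z). Qed.

Lemma ripBr x y z : rip z (x - y) = rip z x - rip z y.
Proof. by rewrite ripC ripBl !(ripC _ z). Qed.

(** Reduces statements on imaginary parts to statements on real parts. *)
Lemma Im_ip x y : complex.Im (ip x y) = rip ((- 'i)%C *: x) y.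
Proof. by rewrite ipZl; case: (ip x y) => u v /=; rewrite oppr0 mul0r; ring. Qed.

Lemma rip_ge0 x : 0 <= rip x x.
Proof. by case: hip. Qed.

Lemma hnorm_ge0 x : 0 <= N x.
Proof. exact: sqrtr_ge0. Qed.

Lemma sqr_hnorm x : N x ^+ 2 = rip x x.
Proof. by rewrite sqr_sqrtr// rip_ge0. Qed.

Lemma hnorm_eq0 x : N x = 0 -> x = 0.
Proof.
case: hip => _ sym _ def x0; apply: def.
have := sqr_hnorm x; rewrite x0 expr0n/=; have := sym x x.
by case: (ip x x) => u v [vN] /= <-; congr (_ +i* _)%C; lra.
Qed.

Lemma hnorm0 : N 0 = 0.
Proof. by rewrite /hnorm rip0l sqrtr0. Qed.

Lemma hnormN x : N (- x) = N x.
Proof. by rewrite /hnorm ripNl ripC ripNl opprK. Qed.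

Lemma hdistC x y : N (x - y) = N (y - x).
Proof. by rewrite -hnormN opprB. Qed.

Lemma cauchy_schwarz x y : rip x y <= N x * N y.
Proof.
have [x0|xn0] := eqVneq (N x) 0.
  by rewrite (hnorm_eq0 x0) rip0l hnorm0 mul0r.
have xgt0 : 0 < N x by rewrite lt_neqAle eq_sym xn0 hnorm_ge0.
(* This vector is [y] minus its real projection on [x]; its squared norm is
   [N y ^ 2 - rip x y ^ 2 / N x ^ 2]. *)
have := rip_ge0 (y - (rip x y / rip x x)%:C%C *: x).
set u := (_ *: x); have uE z : rip u z = rip x y / rip x x * rip x z.
  exact: ripZl.
rewrite ripBl !ripBr (ripC u y) !uE (ripC u x) uE -!sqr_hnorm.
set b := rip x y => h.
have {h} : 0 <= N y ^+ 2 - b ^+ 2 / N x ^+ 2.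
  by apply: le_trans h _; rewrite le_eqVlt; apply/orP; left; apply/eqP; field.
rewrite subr_ge0 ler_pdivrMr ?exprn_gt0// -exprMn mulrC.
have [b0|b0] := leP 0 b; last by rewrite (le_trans (ltW b0))// mulr_ge0// hnorm_ge0.
by rewrite ler_sqr// nnegrE mulr_ge0// hnorm_ge0.
Qed.

Lemma ler_hnormD x y : N (x + y) <= N x + N y.
Proof.
rewrite -ler_sqr ?nnegrE ?addr_ge0 ?hnorm_ge0// sqr_hnorm ripDl !ripDr.
rewrite (ripC x y) sqrrD -!sqr_hnorm; have := cauchy_schwarz x y; lra.
Qed.

Lemma ler_hdist z x y : N (x - y) <= N (x - z) + N (z - y).
Proof. by have := ler_hnormD (x - z) (z - y); rewrite addrA subrK. Qed.

(** * Measurability of vector-valued maps *)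

Lemma hopen_rip_gt f (r : R) : hopen ip [set y | r < rip f y].
Proof.
move=> y /= ry; have f1 : 0 < N f + 1 by rewrite ltr_wpDl// hnorm_ge0.
exists ((rip f y - r) / (N f + 1)); first by rewrite divr_gt0// subr_gt0.
move=> z; rewrite ltr_pdivlMr// mulrDr mulr1 => zy.
have := cauchy_schwarz f (y - z); rewrite ripBr hdistC mulrC.
have := hnorm_ge0 (z - y); lra.
Qed.

Lemma measurable_hopen_Re d (T : measurableType d) (psi : T -> V) :
  (forall U, hopen ip U -> measurable (psi @^-1` U)) ->
  forall f, measurable_fun setT (fun t => complex.Re (ip f (psi t))).
Proof.
move=> mpsi f; apply: (measurability _ (RGenOInfty.measurableE R)).
move=> _ [_ [r ->] <-]; rewrite setTI.
rewrite (_ : _ @^-1` _ = psi @^-1` [set y | r < rip f y]).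
  by apply: mpsi; exact: hopen_rip_gt.
by apply/seteqP; split => t /=; rewrite in_itv/= andbT.
Qed.

Lemma measurable_hopen_Im d (T : measurableType d) (psi : T -> V) :
  (forall U, hopen ip U -> measurable (psi @^-1` U)) ->
  forall f, measurable_fun setT (fun t => complex.Im (ip f (psi t))).
Proof.
move=> mpsi f; under eq_fun do rewrite Im_ip; exact: measurable_hopen_Re.
Qed.

(** Turns a norm bound into countably many half-space conditions. If [a < N w], some [s k] close to
    [w] has [rip (s k) w] near [N w ^ 2], hence above [a * N (s k)]. *)
Lemma hnorm_leP (s : nat -> V) :
  (forall x (e : R), 0 < e -> exists n, N (x - s n) < e) ->
  forall w (a : R), 0 <= a ->
    N w <= a <-> forall k, rip (s k) w <= a * N (s k).
Proof.
move=> s_dense w a a0; split => [wa k|h].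
  rewrite (le_trans (cauchy_schwarz _ _))// mulrC ler_wpM2r//; exact: hnorm_ge0.
rewrite leNgt; apply/negP => aw.
have w0 : 0 < N w by exact: le_lt_trans aw.
have wa0 : 0 < 2 * (N w + a) by rewrite mulr_gt0// ltr_wpDr.
(* The inequalities below give [N w * (N w - a) <= e * (N w + a)] for [e] the distance from [w] to
   [s k]; half the critical value of [e] excludes this. *)
have e0 : 0 < N w * (N w - a) / (2 * (N w + a)).
  by rewrite divr_gt0// mulr_gt0// subr_gt0.
have [k] := s_dense w _ e0; rewrite ltr_pdivlMr// => wk.
have h1 := cauchy_schwarz (w - s k) w; have h2 := h k.
rewrite ripBl -sqr_hnorm expr2 in h1.
have h3 : a * N (s k) <= a * (N w + N (w - s k)).
  by rewrite ler_wpM2l//; have := ler_hdist w (s k) 0; rewrite !subr0 hdistC addrC.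
have h4 := hnorm_ge0 (w - s k).
nra.
Qed.

(** Weak measurability suffices: by [hnorm_leP] a closed ball is a countable intersection of
    half-spaces. *)
Lemma measurable_hdist (s : nat -> V) d (T : measurableType d) (phi : T -> V) :
  (forall x (e : R), 0 < e -> exists n, N (x - s n) < e) ->
  (forall f, measurable_fun setT (fun t => complex.Re (ip f (phi t)))) ->
  forall v, measurable_fun setT (fun t => N (phi t - v)).
Proof.
move=> s_dense mphi v; apply: (measurability _ (measurable_generated_Nyc R)).
move=> _ [_ [a ->] <-]; rewrite setTI; have [a0|a0] := leP 0 a.
  rewrite (_ : _ @^-1` _ = \bigcap_k
      (fun t => rip (s k) (phi t)) @^-1` `]-oo, a * N (s k) + rip (s k) v]%classic).
    apply: bigcap_measurable; first by exists 0%N.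
    move=> k _; rewrite -[X in measurable X]setTI.
    by apply: mphi => //; exact: measurable_itv.
  apply/seteqP; split => t /=; rewrite in_itv/= (hnorm_leP s_dense)//.
    by move=> h k _ /=; rewrite in_itv/=; have := h k; rewrite ripBr; lra.
  by move=> h k; have := h k I; rewrite /= in_itv/= ripBr; lra.
rewrite (_ : _ @^-1` _ = set0)//; apply/seteqP; split => t //=.
by rewrite in_itv/= leNgt (lt_le_trans a0)// hnorm_ge0.
Qed.

(** * Countable bases of balls, and decoding a point from the balls containing it *)

(** The balls need not be centered at [v]: one that contains [v] and has radius below [e] stays
    within [2 * e] of [v]. *)
Definition ball_base (a : nat -> V) (b : nat -> R) :=
  forall v (e : R), 0 < e -> exists2 j, N (v - a j) < b j & b j < e.

Lemma dense_ball_base (s : nat -> V) :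
  (forall x (e : R), 0 < e -> exists n, N (x - s n) < e) ->
  exists a b, ball_base a b.
Proof.
(* [f] enumerates the pairs of a center and a precision; numbers that code no pair repeat
   [(0, 0)]. *)
move=> s_dense; pose f j := odflt (0%N, 0%N) (unpickle j : option (nat * nat)).
exists (fun j => s (f j).1), (fun j => (f j).2.+1%:R^-1) => v e e0.
pose n := Num.truncn e^-1.
have [|k vk] := s_dense v n.+1%:R^-1; first by rewrite invr_gt0.
exists (pickle (k, n)); rewrite /f pickleK//=.
by rewrite -[ltRHS]invrK ltf_pV2 ?posrE ?invr_gt0// truncnS_gt.
Qed.

(** An open set is the union of the countably many basic balls inside it. *)
Lemma hopen_measurable (a : nat -> V) (b : nat -> R) d (T : measurableType d)
    (psi : T -> V) :
  ball_base a b -> (forall j, measurable [set t | N (psi t - a j) < b j]) ->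
  forall U, hopen ip U -> measurable (psi @^-1` U).
Proof.
move=> ab mpsi U oU.
rewrite (_ : _ @^-1` _ = \bigcup_(j in [set j | [set v | N (v - a j) < b j] `<=` U])
    [set t | N (psi t - a j) < b j]); first by apply: bigcup_measurable => j _.
apply/seteqP; split=> [t /= Ut|t [j /= jU]]; last exact: jU.
have [e e0 eU] := oU _ Ut; have [j tj je] := ab (psi t) (e / 2) (divr_gt0 e0 (ltr0Sn _ _)).
exists j => //= v /= vj; apply: eU; have := ler_hdist (a j) v (psi t).
by rewrite (hdistC (a j)); lra.
Qed.

(* [Psi x] is the limit of the centers of the balls selected by [x]: it makes
   sense on the set [E] of those [x] that select arbitrarily small balls, any two
   of them close enough to each other to meet. *)
Lemma ball_decoder (a : nat -> V) (b : nat -> R) d (T : measurableType d)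
    (G : set T) (D : nat -> set T) :
  hcomplete ip -> ball_base a b -> measurable G -> (forall j, measurable (D j)) ->
  exists Psi : T -> V,
    [/\ forall U, hopen ip U -> measurable (Psi @^-1` U),
        forall x, ~ G x -> Psi x = 0 &
        forall x v, G x -> (forall j, D j x <-> N (v - a j) < b j) -> Psi x = v].
Proof.
move=> cV ab mG mD.
pose tiny n := \bigcup_(j in [set j | b j < n.+1%:R^-1]) D j.
pose compat i j := [set x | D i x -> D j x -> N (a i - a j) <= b i + b j].
pose E := G `&` (\bigcap_n tiny n `&` \bigcap_i \bigcap_j compat i j).
have mE : measurable E.
  apply: measurableI => //; apply: measurableI.
    by apply: bigcapT_measurable => n; exact: bigcup_measurable.
  apply: bigcapT_measurable => i; apply: bigcapT_measurable => j.
  (* The inequality on the centers does not involve [x]: if it holds, [compat i j] is everything,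
     otherwise it forbids selecting both balls. *)
  have [ij|ij] := leP (N (a i - a j)) (b i + b j).
    by rewrite (_ : compat i j = setT)//; apply/seteqP; split => x //= _ _ _.
  rewrite (_ : compat i j = ~` (D i `&` D j)).
    by apply: measurableC; exact: measurableI.
  apply/seteqP; split => x /= h; last by move=> Di Dj; case: h.
  by move=> [Di Dj]; have := h Di Dj; rewrite leNgt ij.
have small (e : R) x : 0 < e -> E x -> exists2 j, D j x & b j < e.
  move=> e0 [_ [/(_ (Num.truncn e^-1) I)[j /= bj Dj] _]]; exists j => //.
  rewrite (lt_le_trans bj)// -[leRHS]invrK lef_pV2 ?posrE ?invr_gt0//.
  exact/ltW/truncnS_gt.
have comp x i j : E x -> D i x -> D j x -> N (a i - a j) <= b i + b j.
  by move=> [_ [_ /(_ i I j I)]]; exact.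
(* Centers of selected balls with radii tending to [0] form a Cauchy sequence; compatibility passes
   to its limit. *)
have lim_ex x : E x -> exists v, forall j, D j x -> N (v - a j) <= b j.
  move=> Ex.
  have r0 n : 0 < n.+1%:R^-1 :> R by rewrite invr_gt0.
  have /choice[k kP] n : exists j, D j x /\ b j < n.+1%:R^-1.
    by have [j Dj bj] := small _ _ (r0 n) Ex; exists j.
  have r_small (e : R) : 0 < e -> exists N : nat, forall n, (N <= n)%N -> n.+1%:R^-1 < e.
    move=> e0; exists (Num.truncn e^-1) => n Nn.
    rewrite -[ltRHS]invrK ltf_pV2 ?posrE ?invr_gt0//.
    by rewrite (lt_le_trans (truncnS_gt _))// ler_nat.
  have [|v vP] := cV (a \o k).
    move=> e e0; have [N NP] := r_small _ (divr_gt0 e0 (ltr0Sn _ 1)).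
    exists N => m n /NP Nm /NP Nn /=.
    have := comp _ _ _ Ex (kP m).1 (kP n).1.
    have := lt_trans (kP m).2 Nm; have := lt_trans (kP n).2 Nn; lra.
  exists v => j Dj; apply/ler_addgt0Pr => e e0.
  have [N1 N1P] := vP _ (divr_gt0 e0 (ltr0Sn _ 1)).
  have [N2 N2P] := r_small _ (divr_gt0 e0 (ltr0Sn _ 1)).
  set n := maxn N1 N2; have := comp _ _ _ Ex (kP n).1 Dj.
  have := lt_trans (kP n).2 (N2P _ (leq_maxr N1 N2)).
  have := N1P _ (leq_maxl N1 N2); rewrite -/n.
  have := ler_hdist (a (k n)) v (a j); rewrite /= (hdistC v (a (k n))); lra.
have /choice[Psi PsiP] x : exists v, (E x -> forall j, D j x -> N (v - a j) <= b j) /\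
    (~ E x -> v = 0).
  have [Ex|nE] := pselect (E x); last by exists 0; split => // /nE.
  by have [v vP] := lim_ex _ Ex; exists v; split.
exists Psi; split.
- apply: hopen_measurable ab _ => j.
  (* On [E], the limit lies in the open ball [j] exactly when some selected ball [i] satisfies
     [N (a i - a j) + b i < b j]: take [b i] below half the gap. Off [E], [Psi] is constantly
     [0]. *)
  rewrite (_ : [set _ | _] =
    (E `&` \bigcup_(i in [set i | N (a i - a j) + b i < b j]) D i) `|`
    (~` E `&` [set _ | N (0 - a j) < b j])).
    apply: measurableU; apply: measurableI => //.
    - exact: bigcup_measurable.
    - exact: measurableC.
    - have [h|h] := pselect (N (0 - a j) < b j).
        by rewrite (_ : [set _ | _] = setT)//; apply/seteqP; split => ?.
      by rewrite (_ : [set _ | _] = set0)//; apply/seteqP; split => ?.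
  apply/seteqP; split => x /=.
    have [Ex|nE] := pselect (E x); last by rewrite (PsiP x).2//; right.
    move=> h; left; split=> //.
    have [|i Di bi] := small ((b j - N (Psi x - a j)) / 2) x _ Ex.
      by rewrite divr_gt0// subr_gt0.
    exists i => //=; have := (PsiP x).1 Ex _ Di.
    by have := ler_hdist (Psi x) (a i) (a j); rewrite (hdistC (a i) (Psi x)); lra.
  move=> [[Ex [i /= ij Di]]|[nE]]; last by rewrite (PsiP x).2.
  by have := (PsiP x).1 Ex _ Di; have := ler_hdist (a i) (Psi x) (a j); lra.
- by move=> x nG; apply: (PsiP x).2 => -[].
move=> x v Gx vD.
(* Balls that all contain the point [v] are compatible by the triangle inequality, and arbitrarily
   small ones exist. *)
have Ex : E x.
  split=> //; split=> [n _|i _ j _].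
    have [|j vj bj] := ab v n.+1%:R^-1; first by rewrite invr_gt0.
    by exists j => //; apply/vD.
  move=> /vD vi /vD vj; have := ler_hdist v (a i) (a j).
  by rewrite (hdistC (a i) v); lra.
apply/eqP; rewrite -subr_eq0; apply/eqP/hnorm_eq0.
apply/eqP; rewrite eq_le hnorm_ge0 andbT; apply/ler_addgt0Pr => e e0.
have [j vj bj] := ab v _ (divr_gt0 e0 (ltr0Sn _ 1)).
have := (PsiP x).1 Ex j; rewrite vD => /(_ vj).
by have := ler_hdist (a j) (Psi x) v; rewrite (hdistC (a j) v); lra.
Qed.

End Hilbert_space.

(** * Finite-measure covers from the Bessel bound *)

Section Bessel.
Variables (R : realType) (V : lmodType R[i]) (ip : V -> V -> R[i]).
Hypothesis hip : is_inner_product ip.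
Local Notation N := (hnorm ip).

Lemma abs2_ge0 (z : R[i]) : 0 <= abs2 z.
Proof. by rewrite addr_ge0// sqr_ge0. Qed.

Lemma abs2_ip0r f : abs2 (ip f 0) = 0.
Proof.
by rewrite /abs2 (Im_ip hip) !(ripC hip 0) !(rip0l hip) expr0n/= addr0.
Qed.

Lemma measurable_abs2 d (T : measurableType d) (F : T -> R[i]) :
  measurable_fun setT (fun t => complex.Re (F t)) ->
  measurable_fun setT (fun t => complex.Im (F t)) ->
  measurable_fun setT (fun t => abs2 (F t)).
Proof.
by move=> mRe mIm; apply: measurable_funD; exact: measurable_funX.
Qed.

Lemma abs2_ip_gt0 (s : nat -> V) v :
  (forall x (e : R), 0 < e -> exists n, N (x - s n) < e) ->
  v != 0 -> exists k, 0 < abs2 (ip (s k) v).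
Proof.
move=> s_dense v0; have Nv : 0 < N v.
  rewrite lt_neqAle hnorm_ge0 andbT eq_sym; apply: contra v0.
  by move=> /eqP /(hnorm_eq0 hip) ->.
(* An [s k] nearer to [v] than [N v] has positive real inner product with [v], by Cauchy-Schwarz. *)
have [k vk] := s_dense v _ Nv; exists k; rewrite /abs2 ltr_wpDr ?sqr_ge0//.
rewrite exprn_gt0//; have := cauchy_schwarz hip (v - s k) v.
rewrite (ripBl hip) -(sqr_hnorm hip) expr2.
have : N (v - s k) * N v < N v * N v by rewrite ltr_pM2r.
lra.
Qed.

Lemma bessel_sigma_finite (s : nat -> V) d (X : measurableType d)
    (mu : {measure set X -> \bar R}) (phi : X -> V) :
  (forall x (e : R), 0 < e -> exists n, N (x - s n) < e) ->
  bessel_family ip mu setT phi ->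
  exists A : nat -> set X,
    [/\ forall n, measurable (A n), forall n, (mu (A n) < +oo)%E &
        forall t, phi t != 0 -> exists n, A n t].
Proof.
move=> s_dense [mphi [B hB]].
have mabs f : measurable_fun setT (fun t => abs2 (ip f (phi t))).
  by apply: measurable_abs2; have [] := mphi f.
pose A k m := [set t | (m.+1%:R^-1%:E <= `|(abs2 (ip (s k) (phi t)))%:E|)%E].
pose f n := odflt (0%N, 0%N) (unpickle n : option (nat * nat)).
have r0 m : 0 < m.+1%:R^-1 :> R by rewrite invr_gt0.
exists (fun n => A (f n).1 (f n).2); split => n.
- rewrite -[X in measurable X]setTI; apply: emeasurable_fun_c_infty => //.
  by apply: measurableT_comp => //; exact/measurable_EFinP.
- move: (f n) => [k m]/=.
  have mg : measurable_fun setT (fun t => (abs2 (ip (s k) (phi t)))%:E).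
    exact/measurable_EFinP.
  (* Markov's inequality, with the Bessel bound applied to [s k]. *)
  have := le_integral_abse mu measurableT mg (r0 m); rewrite setTI -/(A k m) => h.
  have : (m.+1%:R^-1%:E * mu (A k m) < +oo)%E.
    apply: le_lt_trans h _.
    under eq_integral do rewrite gee0_abs ?lee_fin ?abs2_ge0//.
    by apply: le_lt_trans (hB (s k)) _; rewrite ltry.
  rewrite !ltey; apply: contra => /eqP ->.
  by rewrite gt0_muley// lte_fin.
- move=> /(abs2_ip_gt0 s_dense)[k k0].
  (* Here [n] is the point of [X]; this precision puts [1/(m+1)] below the positive value at [n]. *)
  exists (pickle (k, Num.truncn (abs2 (ip (s k) (phi n)))^-1)).
  rewrite /A /f pickleK/= lee_fin ger0_norm ?abs2_ge0//.
  rewrite -[leRHS]invrK lef_pV2 ?posrE ?invr_gt0//.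
  exact/ltW/truncnS_gt.
Qed.

End Bessel.

(** * Transport of the family to the interval *)

Lemma measurable_Iint (R : realType) (m : \bar R) :
  measurable (Iint m : set (measurableTypeR R)).
Proof.
apply: is_interval_measurable => s t [s0 _] [_ tm] u /andP[su ut].
by split; [exact: le_trans su|exact: le_lt_trans tm].
Qed.

Theorem theorem2p7 (R : realType) (V : lmodType R[i]) (ip : V -> V -> R[i])
    (hH : separable_hilbert ip)
    (d : measure_display) (X : measurableType d)
    (mu : {measure set X -> \bar R}) (hna : nonatomic mu)
    (phi : X -> V) (hphi : bessel_family ip mu setT phi) :
  exists psi : R -> V,
    bessel_family ip (@lebesgue_measure R) (Iint (mu setT)) psi /\
    forall U : set V, hopen ip U -> ~ U 0 ->
      mu [set t | U (phi t)] =
      (@lebesgue_measure R) [set t | Iint (mu setT) t /\ U (psi t)].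
Proof.
have [hip cV [s s_dense]] := hH; have [mphi [Bd hBd]] := hphi.
have [a [b ab]] := dense_ball_base s_dense.
have [A [mA Aoo phiA]] := bessel_sigma_finite hip s_dense hphi.
pose B j := [set t | hnorm ip (phi t - a j) < b j].
have mB j : measurable (B j).
  have mdist := measurable_hdist hip s_dense (fun f => (mphi f).1) (a j).
  have := mdist measurableT _ (measurable_itv `]-oo, b j[); rewrite setTI.
  by rewrite (_ : _ @^-1` _ = B j).
have [c [D [mc mD c0 cA cD]]] := real_code R mA mB.
pose cm := isMeasurableFun.Build _ _ X (measurableTypeR R) c mc.
pose C : {mfun X >-> measurableTypeR R} := HB.pack c cm.
have mG : measurable (`[0%R, +oo[%classic : set (measurableTypeR R)).
  exact: measurable_itv.
have nuoo (x : R) : (pushforward mu C `[0%R, x]%classic < +oo)%E.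
  have [n An] := cA x; rewrite /= /pushforward.
  apply: (@le_lt_trans _ _ (mu (\bigcup_(i < n) A i))).
    apply: le_measure; rewrite ?inE.
    - by rewrite -[X in measurable X]setTI; apply: (mc) => //; exact: measurable_itv.
    - exact: bigcup_measurable.
    - by move=> t /=; rewrite in_itv/= => /An.
  elim: n {An} => [|n IH]; first by rewrite bigcup_mkord big_ord0 measure0.
  rewrite bigcup_mkord big_ord_recr/= -bigcup_mkord.
  apply: le_lt_trans (measureU2 _ _ _) _ => //; first exact: bigcup_measurable.
  by apply: lte_add_pinfty; [exact: IH|exact: Aoo].
have [q [mq q0 qE]] := quantile_transport nuoo.
have mDR j : measurable (D j : set (measurableTypeR R)) by exact: mD.
have [Psi [mPsi Psi0 PsiE]] := ball_decoder hip cV ab mG mDR.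
(* Where [c t < 0], the point [t] is in no [A n], so [phi t = 0]. *)
have Psic t : Psi (c t) = phi t.
  have [ct|ct] := leP 0 (c t).
    by apply: PsiE => [|j]; [rewrite /= in_itv/= ct|exact: cD].
  rewrite Psi0; last by rewrite /= in_itv/= andbT leNgt ct.
  apply/esym/eqP; apply: contraTT ct => /phiA /c0.
  by rewrite -leNgt.
have Psi_ge0 x : Psi x <> 0 -> 0 <= x.
  move=> Px; rewrite leNgt; apply/negP => x0; apply/Px/Psi0.
  by rewrite /= in_itv/= andbT leNgt x0.
(* [q] is nonnegative only below the mass of [[0, +oo[] under the image measure, which is at most
   [mu setT]. *)
have psi_Iint t : Psi (q t) <> 0 -> Iint (mu setT) t.
  move=> /Psi_ge0 /q0[t0 tM]; split => //; apply: lt_le_trans tM _.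
  rewrite /= /pushforward; apply: le_measure; rewrite ?inE//.
  by rewrite -[X in measurable X]setTI; exact: (mc measurableT _ mG).
have mpsi U : hopen ip U -> measurable ((Psi \o q) @^-1` U : set (measurableTypeR R)).
  move=> oU; rewrite comp_preimage -[X in measurable X]setTI.
  exact: (mq measurableT _ (mPsi _ oU)).
exists (Psi \o q); split; last first.
  move=> U oU U0.
  have -> : [set t | U (phi t)] = C @^-1` (Psi @^-1` U).
    by apply/seteqP; split => t /=; rewrite Psic.
  (* As [U] avoids [0], its preimage under [Psi] lies in [[0, +oo[], where the image measures under
     [c] and [q] agree. *)
  rewrite -[LHS]/(pushforward mu C (Psi @^-1` U)) qE; last 2 first.
  - exact: mPsi.
  - move=> x /= Ux; rewrite in_itv/= andbT; apply: Psi_ge0 => Px.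
    by rewrite Px in Ux.
  congr (lebesgue_measure _); apply/seteqP; split => t /=; last by case.
  by move=> Ut; split => //; apply: psi_Iint => Pq; rewrite Pq in Ut.
split.
  move=> f; split; apply: measurable_funTS.
    exact: (measurable_hopen_Re hip mpsi f).
  exact: (measurable_hopen_Im hip mpsi f).
(* The bound is kept: the integral over the interval is at most that over the line, which equals the
   integral for [phi]. *)
exists Bd => f; apply: le_trans (hBd f).
pose g (x : measurableTypeR R) := (abs2 (ip f (Psi x)))%:E.
have g0 x : (0 <= g x)%E by rewrite lee_fin abs2_ge0.
have mg : measurable_fun setT g.
  apply/measurable_EFinP; apply: measurable_abs2.
    exact: (measurable_hopen_Re hip mPsi f).
  exact: (measurable_hopen_Im hip mPsi f).
pose qm := isMeasurableFun.Build _ _ _ _ _ mq.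
pose Q : {mfun measurableTypeR R >-> measurableTypeR R} := HB.pack q qm.
pose G : set (measurableTypeR R) := `[0%R, +oo[%classic.
have gN x : ~ G x -> g x = 0%E.
  by move=> Gx; rewrite /g Psi0// abs2_ip0r.
(* The image measures are compared only on subsets of [G]; since [g] vanishes off [G], integrals
   restrict to it. *)
have pushE d' (Y : measurableType d') (nu : {measure set Y -> \bar R})
    (h : {mfun Y >-> measurableTypeR R}) :
    (\int[nu]_y g (h y) = \int[pushforward nu h]_(x in G) g x)%E.
  rewrite [RHS]ge0_integral_pushforward//; last exact: measurable_funTS.
  rewrite [RHS]integral_mkcond; apply: eq_integral => y _ /=.
  rewrite patchE; case: ifPn => //; by rewrite notin_setE => /gN.
apply: (@le_trans _ _ (\int[lebesgue_measure]_s g (Q s))%E).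
  apply: ge0_subset_integral => //; first exact: measurable_Iint.
    exact: (measurableT_comp mg mq).
  by move=> x _; exact: g0.
have -> : (\int[mu]_t (abs2 (ip f (phi t)))%:E = \int[mu]_t g (C t))%E.
  by apply: eq_integral => t _; rewrite /g /= Psic.
rewrite (pushE _ _ _ Q) (pushE _ _ _ C).
rewrite (@eq_measure_integral _ _ _ _ (pushforward mu C))//.
by move=> E mE EG; rewrite qE.
Qed.
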